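(* (Banach's matchbox problem.) A mathematician carries two matchboxes, one in each of his two pockets, each containing initially exactly $n$ matches. Each time he needs a match he selects one of the two pockets at random (each with probability $\frac12$, independently) and removes one match from the box in it. Let $X_n$ be the number of matches remaining in the other box at the moment when the first box is empty. Then, as $n\to\infty$, $$\frac{X_n}{\sqrt n}\stackrel{d}{\to}\mathcal{H}(\sqrt2).$$
   Context: $\mathcal{H}(\sigma)$ is the half-normal distribution with density $\sqrt{\frac{2}{\pi\sigma^2}}\exp\left(-\frac{x^2}{2\sigma^2}\right)$, $x\ge0$. The moment when the first box is empty is the moment when the last match of one of the boxes is removed. $\stackrel{d}{\to}$ denotes convergence in distribution. *)

(* Defs.v *)
From HB Require Import structures.
From mathcomp Require Import all_boot all_order all_algebra finmap.
From mathcomp Require Import interval_inference ring.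
From mathcomp Require Import all_classical all_reals all_analysis.
From mathcomp Require Import measurable_realfun.

Set Implicit Arguments.
Unset Strict Implicit.
Unset Printing Implicit Defensive.

Import Order.TTheory GRing.Theory Num.Theory.
Import numFieldNormedType.Exports.

Local Open Scope classical_set_scope.
Local Open Scope ring_scope.

Section halfnormal.
Context {R : realType}.
Local Notation mu := (@lebesgue_measure R).

Definition halfnormal_pdf (s x : R) : R :=
  if 0 <= x then Num.sqrt (2 / (pi * s ^+ 2)) * expR (- (x ^+ 2 / (2 * s ^+ 2)))
  else 0.

Definition halfnormal_prob (s : {posnum R}) : set R -> \bar R :=
  fun V => (\int[mu]_(x in V) (halfnormal_pdf s%:num x)%:E)%E.

Lemma halfnormal_pdf_ge0 (s x : R) : 0 <= halfnormal_pdf s x.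
Proof.
by rewrite /halfnormal_pdf; case: ifP => // _; rewrite mulr_ge0 ?sqrtr_ge0 ?expR_ge0.
Qed.

Lemma halfnormal_pdfE (s : {posnum R}) (x : R) : 0 <= x ->
  halfnormal_pdf s%:num x = 2 * normal_pdf 0 s%:num x.
Proof.
move=> x0; rewrite /halfnormal_pdf x0 normal_pdfE// [in RHS]mulrA.
rewrite /normal_peak /normal_fun subr0; congr (_ * _); last first.
  by rewrite mulNr mulr_natl.
have pis : 0 < pi * s%:num ^+ 2 :> R by rewrite mulr_gt0 ?pi_gt0.
have e : 2 / (pi * s%:num ^+ 2) = 2 ^+ 2 / (s%:num ^+ 2 * pi *+ 2) :> R.
  move: (pi) (pi_gt0 R) => p p0; field; by rewrite !gt_eqF.
by rewrite e sqrtrM ?sqr_ge0// sqrtr_sqr ger0_norm// sqrtrV// mulrn_wge0// mulrC ltW.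
Qed.

Lemma halfnormal_pdf_restrict (s : {posnum R}) :
  halfnormal_pdf s%:num = (fun x => 2 * normal_pdf 0 s%:num x) \_ `[0, +oo[.
Proof.
apply/funext => x /=; rewrite patchE mem_setE in_itv/= andbT.
case: ifPn => x0; first by rewrite halfnormal_pdfE.
by rewrite /halfnormal_pdf (negbTE x0).
Qed.

Lemma measurable_halfnormal_pdf (s : {posnum R}) :
  measurable_fun [set: R] (halfnormal_pdf s%:num).
Proof.
rewrite halfnormal_pdf_restrict; apply/(measurable_restrictT _ _).1 => //.
apply: measurable_funTS; apply: measurable_funM => //.
exact: measurable_normal_pdf.
Qed.

Lemma integral_halfnormal_pdf (s : {posnum R}) :
  (\int[mu]_x (halfnormal_pdf s%:num x)%:E = 1)%E.
Proof.
transitivity (\int[mu]_(x in `[0%R, +oo[) (2%:E * (normal_pdf 0 s%:num x)%:E))%E.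
  rewrite [RHS]integral_mkcond; apply: eq_integral => x _.
  by rewrite halfnormal_pdf_restrict !patchE; case: ifP.
rewrite ge0_integralZl//; last 2 first.
- by apply/measurable_EFinP/measurable_funTS; exact: measurable_normal_pdf.
- by move=> x _; rewrite lee_fin normal_pdf_ge0.
rewrite -(integral_normal_pdf 0 s%:num) ge0_symfun_integralT//=.
- by congr (_ * integral _ _ _)%E; apply/seteqP; split => x /=; rewrite in_itv/= andbT.
- by move=> x; exact: normal_pdf_ge0.
- exact: continuous_normal_pdf.
- move=> x /=; rewrite !normal_pdfE// /normal_fun !subr0 sqrrN//.
Qed.

Let halfnormal0 s : halfnormal_prob s set0 = 0%E.
Proof. by rewrite /halfnormal_prob integral_set0. Qed.

Let halfnormal_ge0 s A : (0 <= halfnormal_prob s A)%E.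
Proof. by apply: integral_ge0 => x _; rewrite lee_fin halfnormal_pdf_ge0. Qed.

Let halfnormal_sigma_additive s : semi_sigma_additive (halfnormal_prob s).
Proof.
move=> /= A mA tA mUA; pose f x := (halfnormal_pdf s%:num x)%:E.
have f0 x : (\bigcup_n A n) x -> (0 <= f x)%E.
  by rewrite lee_fin halfnormal_pdf_ge0.
have mf : measurable_fun (\bigcup_n A n) f.
  by apply/measurable_EFinP/measurable_funTS; exact: measurable_halfnormal_pdf.
have -> : halfnormal_prob s (\bigcup_n A n) =
    (\sum_(i <oo) halfnormal_prob s (A i))%E.
  exact: (ge0_integral_bigcup mu mA mf f0 tA).
apply: (@is_cvg_ereal_nneg_natsum_cond _ _ 0%N) => n _ _.
exact: (halfnormal_ge0 s).
Qed.

HB.instance Definition _ s := isMeasure.Build _ _ _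
  (halfnormal_prob s) (halfnormal0 s) (@halfnormal_ge0 s)
  (@halfnormal_sigma_additive s).

Let halfnormal_setT s : halfnormal_prob s [set: _] = 1%E.
Proof. exact: integral_halfnormal_pdf. Qed.

HB.instance Definition _ s :=
  @Measure_isProbability.Build _ _ R (halfnormal_prob s) (halfnormal_setT s).

End halfnormal.

(* The random variables X n may live on different probability spaces. *)
Definition cvg_in_distribution (R : realType) (d : nat -> measure_display)
    (T : forall n, measurableType (d n)) (P : forall n, probability (T n) R)
    (X : forall n, {RV (P n) >-> R}) (nu : probability R R) : Prop :=
  forall x : R, {for x, continuous (fun r : R => nu `]-oo, r]%classic)} ->
    cdf (X n) x @[n --> \oo] --> nu `]-oo, x]%classic.

Definition mutually_independent d d' (T : measurableType d)
    (T' : measurableType d') (R : realType) (P : probability T R)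
    (I : choiceType) (X : I -> {RV P >-> T'}) : Prop :=
  forall (J : {fset I}) (A : I -> set T'), (forall i, measurable (A i)) ->
    P (\bigcap_(i in [set` J]) (X i @^-1` A i)) =
    (\prod_(i <- J) P (X i @^-1` A i))%E.

Definition fair_choices d (T : measurableType d) (R : realType)
    (P : probability T R) (C : nat -> {RV P >-> bool}) : Prop :=
  mutually_independent C /\
  forall k b, P (C k @^-1` [set b]) = (2^-1)%:E.

Section matchboxes.
Local Open Scope nat_scope.
Implicit Types (n k : nat) (c : nat -> bool) (b : nat * nat).

(* [c k] is the pocket chosen at the k-th draw, [true] being the left one. *)
Fixpoint boxes n c k : nat * nat :=
  if k is k'.+1 then
    let b := boxes n c k' in
    if c k' then (b.1.-1, b.2) else (b.1, b.2.-1)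
  else (n, n).

Definition some_empty b : bool := (b.1 == 0) || (b.2 == 0).

Lemma boxes_bound n c k :
  some_empty (boxes n c k) || ((boxes n c k).1 + (boxes n c k).2 + k == n.*2).
Proof.
elim: k => [|k] /=; first by rewrite addn0 addnn eqxx orbT.
case: (boxes n c k) => l r; rewrite /some_empty /=.
by case: (c k); case: l => [|l]; case: r => [|r]; rewrite //= ?orbT // => /eqP <-;
  rewrite ?addnS ?addSn eqxx !orbT.
Qed.

Lemma boxes_emptied n c : some_empty (boxes n c n.*2).
Proof.
case/orP: (boxes_bound n c n.*2) => // /eqP.
move/(congr1 (subn^~ n.*2)); rewrite addnK subnn => /eqP.
by rewrite addn_eq0 /some_empty => /andP[->].
Qed.

Lemma ex_some_empty n c : exists k, some_empty (boxes n c k).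
Proof. by exists n.*2; exact: boxes_emptied. Qed.

Definition first_empty_time n c : nat := ex_minn (ex_some_empty n c).

Definition other_box n c : nat :=
  let b := boxes n c (first_empty_time n c) in
  if b.1 == 0 then b.2 else b.1.

Lemma boxes_ext n c c' k : (forall i, i < k -> c i = c' i) ->
  boxes n c k = boxes n c' k.
Proof.
elim: k => //= k IH h; rewrite h// IH// => i ik; exact/h/ltnW.
Qed.

Lemma other_box_ext n c c' : (forall i, i < n.*2 -> c i = c' i) ->
  other_box n c = other_box n c'.
Proof.
move=> h; have E k : k <= n.*2 -> boxes n c k = boxes n c' k.
  by move=> kn; apply: boxes_ext => i ik; apply: h; exact: leq_trans kn.
rewrite /other_box /first_empty_time.
case: ex_minnP => m Hm minm; case: ex_minnP => m' Hm' minm'.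
have mn : m <= n.*2 by apply: minm; exact: boxes_emptied.
have m'n : m' <= n.*2 by apply: minm'; exact: boxes_emptied.
have -> : m = m'.
  by apply/eqP; rewrite eqn_leq minm ?E// minm'// -E.
by rewrite E.
Qed.

End matchboxes.

Section remaining_matches.
Context d (T : measurableType d) (R : realType) (P : probability T R).

Definition remaining_matches (n : nat) (C : nat -> {RV P >-> bool}) : T -> R :=
  fun t => (other_box n (fun k => C k t))%:R.

Variables (n : nat) (C : nat -> {RV P >-> bool}).

Lemma measurable_remaining_matches :
  measurable_fun [set: T] (remaining_matches n C).
Proof.
move=> _ A mA; rewrite setTI.
pose D := [set s : n.*2.-tuple bool | A (other_box n (nth false s))%:R].
rewrite (_ : _ @^-1` _ =
  \bigcup_(s in D) \bigcap_(i in [set: 'I_n.*2]) (C i @^-1` [set tnth s i])).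
  apply: fin_bigcup_measurable; first exact: finite_finset.
  move=> s _; apply: fin_bigcap_measurable; first exact: finite_finset.
  by move=> i _; rewrite -[X in measurable X]setTI; exact: measurable_funP.
have oE (s : n.*2.-tuple bool) t : (forall i, C (val i) t = tnth s i) ->
    other_box n (fun k => C k t) = other_box n (nth false s).
  move=> h; apply: other_box_ext => i ni.
  by rewrite (h (Ordinal ni)) (tnth_nth false).
apply/seteqP; split => t /=; rewrite /remaining_matches.
  move=> At; pose s := [tuple C (val i) t | i < n.*2].
  have sE i : C (val i) t = tnth s i by rewrite tnth_mktuple.
  by exists s => [|i _]; [rewrite /D /mkset -(oE s t sE)|exact: sE].
by move=> [s Ds h]; rewrite (oE s)// => i; exact: h.
Qed.

HB.instance Definition _ := isMeasurableFun.Build _ _ _ _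
  (remaining_matches n C) measurable_remaining_matches.

End remaining_matches.

(* Main.v *)
Require Import Defs.
From mathcomp Require Import all_boot all_order all_algebra finmap.
From mathcomp Require Import interval_inference lra ring zify.
From mathcomp Require Import all_classical all_reals all_analysis.
From mathcomp Require Import measurable_realfun.
Import Order.TTheory GRing.Theory Num.Theory.
Import numFieldNormedType.Exports.
Local Open Scope classical_set_scope.
Local Open Scope ring_scope.

(** The proof is a local limit theorem for the law of X_n, read off without
Stirling's formula.  Write n = m + 1.  The event X_n = j + 1 says that the
draw number N = 2 m - j (counting from 0) takes the last match of its pocket,
that is, that this pocket was chosen exactly m times among the N draws before
([other_boxP]).  The first N choices are uniform on the binary words, so
P(X_n = j + 1) = C(N, m) / 2 ^ N for 0 <= j <= m ([other_box_law]).

The quotient of two consecutive probabilities is 1 - j / (2 m - j), so that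
P(X_n = j + 1) is P(X_n = 1) times the product [weight m j] of these quotients,
and comparing 1 - u with exponentials encloses [weight m j] between
exp (- j (j - 1) / (4 (m - j))) and exp (- j (j - 1) / (4 (m + 1)))
([weight_ge], [weight_le]).  For j close to t sqrt n both tend to
exp (- t ^ 2 / 4), which is the half-normal density of parameter sqrt 2 up to a
constant ([cvg_weight]).

The factor P(X_n = 1) never has to be estimated: since the probabilities add up
to 1, P(X_n / sqrt n <= x) is the sum of the weights with
(j + 1) / sqrt n <= x divided by the sum of all weights
([remaining_matches_weight]).  Multiplied by the mesh 1 / sqrt n and by the
value of the density at 0, numerator and denominator are integrals of step
functions that converge pointwise to the density on ]-oo, x[ and on the whole
line, under a common Gaussian bound; by dominated convergence they tend to the
half-normal probabilities of these two sets ([cvg_riemann]), the second being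
1. *)

(** * Draws and boxes *)

Section draws.
Local Open Scope nat_scope.
Implicit Types (c : nat -> bool) (b : bool).

Definition draws c b k := \sum_(i < k) (c i == b).

Lemma drawsS c b k : draws c b k.+1 = draws c b k + (c k == b).
Proof. by rewrite /draws big_ord_recr. Qed.

Lemma draws_leS c b k : draws c b k <= draws c b k.+1.
Proof. by rewrite drawsS leq_addr. Qed.

Lemma draws_total c b k : draws c b k + draws c (~~ b) k = k.
Proof.
elim: k => [|k IH]; first by rewrite /draws !big_ord0.
by rewrite !drawsS addnACA IH; case: (c k); case: b {IH}; rewrite ?addn0 ?addn1.
Qed.

(** The truncated predecessor in [boxes] keeps an empty box empty, as does the
truncated subtraction of the number of draws. *)
Lemma boxesE n c k : boxes n c k = (n - draws c true k, n - draws c false k).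
Proof.
elim: k => [|k IH] /=; first by rewrite /draws !big_ord0 subn0.
by rewrite IH !drawsS; case: (c k) => /=; rewrite addn0 addn1 subnS.
Qed.

Lemma some_emptyE n c k :
  some_empty (boxes n c k) = (n <= draws c true k) || (n <= draws c false k).
Proof. by rewrite boxesE /some_empty /= !subn_eq0. Qed.

Lemma some_emptyS n c k :
  some_empty (boxes n c k) -> some_empty (boxes n c k.+1).
Proof.
rewrite !some_emptyE => /orP[] h; apply/orP; [left|right];
  exact: leq_trans h (draws_leS _ _ _).
Qed.

(** Once a box is empty some box stays empty, so the first time is the only
passage from no empty box to some empty box. *)
Lemma first_empty_timeS n c N :
  ~~ some_empty (boxes n c N) -> some_empty (boxes n c N.+1) ->
  first_empty_time n c = N.+1.
Proof.
move=> eN eS; rewrite /first_empty_time; case: ex_minnP => k ek mink.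
apply/eqP; rewrite eqn_leq mink// ltnNge; apply/negP => kN.
case/negP: eN; rewrite -(subnKC kN).
by elim: (N - k) => [|i IH]; rewrite ?addn0// addnS; exact: some_emptyS.
Qed.

(** Draw [N] takes the last match of pocket [c N] while the other box is not yet
empty, so [N.+1] is the first time at which a box is empty and the other box
lacks the draws made from it. *)
Lemma other_box_emptying m c N :
  draws c (c N) N = m -> draws c (~~ c N) N <= m ->
  other_box m.+1 c = m.+1 - draws c (~~ c N) N.
Proof.
move=> dN dN'; rewrite /other_box (@first_empty_timeS _ _ N) ?some_emptyE.
- rewrite boxesE !drawsS; case: (c N) dN dN' => /= -> dN';
    rewrite addn0 addn1 subnn//= subn_eq0.
  by rewrite ltnNge dN'.
- by case: (c N) dN dN' => /= -> dN'; rewrite !ltnNge dN' leqnn.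
- by rewrite !drawsS; case: (c N) dN dN' => /= -> dN'; rewrite addn1 leqnn ?orbT.
Qed.

(** The draw just before the first time at which a box is empty: by minimality
both pockets were chosen at most [m] times before it. *)
Lemma ex_emptying m c : exists N, 
  draws c (c N) N = m /\ draws c (~~ c N) N <= m.
Proof.
have [k] := ex_some_empty m.+1 c; elim: k => [|k IH].
  by rewrite some_emptyE /draws !big_ord0.
case: (boolP (some_empty (boxes m.+1 c k))) => [/IH//|].
rewrite !some_emptyE !drawsS negb_or -!leqNgt => /andP[t f] h; exists k.
by case: (c k) h => /=; rewrite addn0 addn1 => h; split => //; lia.
Qed.

(** If [j.+1] matches are left when a box gets empty, then the two boxes have lost
[2 (m + 1) - (j + 1)] matches, so the emptying draw has index [2 m - j], counting
from 0.  Conversely, if the pocket chosen at that draw was chosen [m] times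
before, the other one was chosen only [m - j] times. *)
Lemma other_boxP m c j : j <= m ->
  other_box m.+1 c = j.+1 <-> draws c (c (m.*2 - j)) (m.*2 - j) = m.
Proof.
move=> jm; split => [|dN]; last first.
  by have := draws_total c (c (m.*2 - j)) (m.*2 - j); rewrite dN => h;
     rewrite (other_box_emptying _ _ _ dN); lia.
have [N [dN dN']] := ex_emptying m c.
rewrite (other_box_emptying _ _ _ dN dN') => h.
by have := draws_total c (c N) N => e; have -> : m.*2 - j = N by lia.
Qed.

Lemma other_box_itv m c : 0 < other_box m.+1 c <= m.+1.
Proof.
have [N [dN dN']] := ex_emptying m c.
by rewrite (other_box_emptying _ _ _ dN dN'); lia.
Qed.

End draws.

(** * The law of the number of remaining matches *)

Section law.
Context d (T : measurableType d) (R : realType) (P : probability T R).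
Variable C : nat -> {RV P >-> bool}.
Hypothesis fair : fair_choices C.

(** The number of draws from one pocket is followed by a prescribed word of
choices so that peeling off the last of the [N] draws, which lengthens the
word, stays within the family: Pascal's rule then gives the law by induction on
[N], and independence is used for cylinders only. *)
Definition draws_then (b : bool) (N j : nat) (w : seq bool) : set T :=
  [set t | draws (fun k => C k t) b N = j /\
           forall i, (i < size w)%N -> C (N + i)%N t = nth b w i].

Lemma measurable_choice k b : measurable (C k @^-1` [set b]).
Proof. exact: measurable_funPTI. Qed.

Lemma draws_then0 b j w : draws_then b 0 j w =
  if j is 0%N then
    \bigcap_(i in [set` [fset val i | i : 'I_(size w)]%fset])
      (C i @^-1` [set nth b w i])
  else set0.
Proof.
case: j => [|j]; apply/seteqP; split => t //=.
- by move=> [_ h] _ /imfsetP[/= i _ ->]; exact: h.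
- move=> h; split=> [|i iw]; first by rewrite /draws big_ord0.
  by apply: h; apply/imfsetP; exists (Ordinal iw).
- by case; rewrite /draws big_ord0.
Qed.

Lemma draws_thenS0 b N w :
  draws_then b N.+1 0 w = draws_then b N 0 (~~ b :: w).
Proof.
apply/seteqP; split => t /=.
- move=> [+ h]; rewrite drawsS => /eqP; rewrite addn_eq0 => /andP[/eqP dN].
  rewrite eqb0 => CN; split=> // -[_|i iw] /=.
    by rewrite addn0; case: (C N t) CN; case: (b).
  by rewrite addnS -addSn; exact: h.
- move=> [dN h]; have := h 0%N isT; rewrite addn0 /= => CN.
  split=> [|i iw]; first by rewrite drawsS dN CN; case: (b).
  by rewrite addSn -addnS; exact: (h i.+1).
Qed.

Lemma draws_thenSS b N j w : draws_then b N.+1 j.+1 w =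
  draws_then b N j (b :: w) `|` draws_then b N j.+1 (~~ b :: w).
Proof.
apply/seteqP; split => t /=.
- move=> [+ h]; rewrite drawsS.
  case: eqVneq => CN dN; [left|right].
    split=> [|[_|i iw] /=]; [lia|by rewrite addn0|].
    by rewrite addnS -addSn; exact: h.
  split=> [|[_|i iw] /=]; [lia| |].
    by rewrite addn0; case: (C N t) CN; case: (b).
  by rewrite addnS -addSn; exact: h.
- case=> -[dN h]; have := h 0%N isT; rewrite addn0 /= => CN.
    split=> [|i iw]; first by rewrite drawsS dN CN eqxx addn1.
    by rewrite addSn -addnS; exact: (h i.+1).
  split=> [|i iw]; first by rewrite drawsS dN CN; case: (b); rewrite addn0.
  by rewrite addSn -addnS; exact: (h i.+1).
Qed.

Lemma draws_then_disjoint b N j j' w :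
  draws_then b N j (b :: w) `&` draws_then b N j' (~~ b :: w) = set0.
Proof.
apply/seteqP; split => t //= -[[_ /(_ 0%N isT) +] [_ /(_ 0%N isT)]].
by move=> /= ->; case: (b).
Qed.

Lemma measurable_draws_then b N j w : measurable (draws_then b N j w).
Proof.
elim: N j w => [|N IH] [|j] w.
- rewrite draws_then0; apply: fin_bigcap_measurable; first exact: finite_fset.
  by move=> i _; exact: measurable_choice.
- by rewrite draws_then0.
- by rewrite draws_thenS0.
- by rewrite draws_thenSS; exact: measurableU.
Qed.

(** Each of the [2 ^ (N + size w)] words of choices has the same probability;
Pascal's rule counts the good ones. *)
Lemma draws_then_law b N j w :
  P (draws_then b N j w) = ('C(N, j)%:R / 2 ^+ (N + size w))%:E.
Proof.
elim: N j w => [|N IH] [|j] w.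
- rewrite draws_then0 fair.1//.
  under eq_bigr do rewrite fair.2.
  rewrite prodEFin big_const_seq count_predT card_imfset//=; last exact: val_inj.
  by rewrite -cardE card_ord iter_mulr_1 exprVn bin0 mul1r.
- by rewrite draws_then0 measure0 bin0n mul0r.
- by rewrite draws_thenS0 IH !bin0 /= addnS.
- transitivity (P (draws_then b N j (b :: w)) +
      P (draws_then b N j.+1 (~~ b :: w)))%E.
    rewrite draws_thenSS; apply: measureU; last exact: draws_then_disjoint;
      exact: measurable_draws_then.
  by rewrite !IH -EFinD -mulrDl /= addnS binS natrD [X in X / _]addrC.
Qed.

(** The emptying pocket may be either one; the two cases have the same
probability, and their number cancels the probability [1 / 2] of the emptying
draw itself. *)
Lemma other_box_law m j : (j <= m)%N ->
  P [set t | other_box m.+1 (fun k => C k t) = j.+1] =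
  ('C(m.*2 - j, m)%:R / 2 ^+ (m.*2 - j))%:E.
Proof.
move=> jm; set N := (m.*2 - j)%N.
rewrite (_ : mkset _ =
    draws_then true N m [:: true] `|` draws_then false N m [:: false]).
  transitivity (P (draws_then true N m [:: true]) +
      P (draws_then false N m [:: false]))%E; last first.
    rewrite !draws_then_law -EFinD addn1 exprSr; congr _%:E.
    by field; rewrite expf_neq0.
  apply: measureU; [exact: measurable_draws_then..|].
  apply/seteqP; split => t //= -[[_ /(_ 0%N isT) +] [_ /(_ 0%N isT)]].
  by move=> /= ->.
apply/seteqP; split => t /=.
- move/other_boxP => /(_ jm); rewrite -/N => h.
  by case E: (C N t) h => h; [left|right]; split => //= -[]//; rewrite addn0 E.
- by case=> -[dN /(_ 0%N isT)]; rewrite addn0 /= => CN;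
    apply/other_boxP => //; rewrite -/N CN.
Qed.

Lemma measurable_other_box m j :
  measurable [set t | other_box m.+1 (fun k => C k t) = j].
Proof.
rewrite (_ : mkset _ = remaining_matches m.+1 C @^-1` [set j%:R]).
  exact: (measurable_funPTI (remaining_matches m.+1 C)).
apply/seteqP; split => t; rewrite /remaining_matches /=; first by move=> ->.
by move=> /eqP; rewrite eqr_nat => /eqP.
Qed.

(** The events that [j.+1] matches remain, for [j <= m], partition the space. *)
Lemma remaining_matches_law m (A : set R) :
  P (remaining_matches m.+1 C @^-1` A) =
  (\sum_(j < m.+1 | j.+1%:R \in A) 'C(m.*2 - j, m)%:R / 2 ^+ (m.*2 - j))%:E.
Proof.
pose F (j : 'I_m.+1) := [set t | other_box m.+1 (fun k => C k t) = j.+1].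
rewrite (_ : _ @^-1` _ = \big[setU/set0]_(j < m.+1 | j.+1%:R \in A) F j).
  rewrite measure_bigsetU_ord_cond; first last.
  - by rewrite /F => i j _ _ [t [/= -> []]] /ord_inj.
  - by move=> j _; exact: measurable_other_box.
  by rewrite -sumEFin; apply: eq_bigr => j _; apply: other_box_law; rewrite -ltnS.
rewrite -bigcup_seq_cond; apply/seteqP; split => t /=.
- move=> At; have := other_box_itv m (fun k => C k t) => h.
  have jm : ((other_box m.+1 (fun k => C k t)).-1 < m.+1)%N by lia.
  exists (Ordinal jm); rewrite /F /=; last lia.
  by rewrite mem_index_enum /=; apply/mem_set; rewrite prednK//; lia.
- by move=> [j /andP[_ /set_mem Aj] tj]; rewrite /remaining_matches tj.
Qed.

End law.

(** * Quotients of the probabilities *)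

Section weight.
Context {R : realType}.

(** The quotient of the probabilities of [j.+1] and of 1 remaining matches. *)
Definition weight m j : R := \prod_(i < j) (1 - i%:R / (m.*2%:R - i%:R)).

Lemma weightS m j :
  weight m j.+1 = weight m j * (1 - j%:R / (m.*2%:R - j%:R)).
Proof. by rewrite /weight big_ord_recr. Qed.

Lemma binomial_weight m j : (j <= m)%N ->
  'C(m.*2 - j, m)%:R / 2 ^+ (m.*2 - j) =
  'C(m.*2, m)%:R / 2 ^+ m.*2 * weight m j :> R.
Proof.
elim: j => [_|j IH jm]; first by rewrite /weight big_ord0 subn0 mulr1.
rewrite weightS mulrA -[X in _ = X * _](IH (ltnW jm)) subnS.
have N0 : (0 < m.*2 - j)%N by lia.
have /(congr1 (fun k => k%:R : R)) := mul_bin_down (m.*2 - j) m.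
rewrite !natrM (_ : (m.*2 - j - m = m - j)%N); last lia.
rewrite !natrB; [|lia..].
rewrite -[in 2 ^+ (_ - j)](prednK N0) exprS.
have : m.*2%:R - j%:R != 0 :> R by rewrite -natrB ?pnatr_eq0; lia.
have : 2 ^+ (m.*2 - j).-1 != 0 :> R by rewrite expf_neq0.
have -> : m.*2%:R = 2 * m%:R :> R by rewrite -muln2 natrM mulrC.
move: ('C(_, _)%:R) ('C(_, _)%:R) (2 ^+ _) => b a q q0 d0 e.
have -> : a = (m%:R - j%:R) * b / (2 * m%:R - j%:R) by rewrite -e; field.
by field; rewrite d0.
Qed.

Lemma weight_ge0 m j : (j <= m)%N -> 0 <= weight m j.
Proof.
move=> jm; apply: prodr_ge0 => i _.
have : i%:R + 1 <= m%:R :> R by rewrite natr1 ler_nat; have := ltn_ord i; lia.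
have : 0 <= i%:R :> R by [].
rewrite -muln2 natrM => i0 im.
by rewrite subr_ge0 ler_pdivrMr ?mul1r; lra.
Qed.

(** Each factor is at most [expR (- i / (2 (m + 1)))], because [1 + x <= expR x];
the exponents add up to the one in the statement. *)
Lemma weight_le m j : (j <= m)%N ->
  weight m j <= expR (- (j%:R * (j%:R - 1) / (4 * m.+1%:R))).
Proof.
elim: j => [_|j IH jm]; first by rewrite /weight big_ord0 !mul0r oppr0 expR0.
have jm' : j%:R + 1 <= m%:R :> R by rewrite natr1 ler_nat.
have j0 : 0 <= j%:R :> R by [].
rewrite weightS.
apply: (@le_trans _ _ (expR (- (j%:R * (j%:R - 1) / (4 * m.+1%:R))) *
  expR (- (j%:R / (2 * m.+1%:R))))).
  apply: ler_pM; [exact/weight_ge0/ltnW| |exact/IH/ltnW|].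
    rewrite -muln2 natrM subr_ge0 ler_pdivrMr ?mul1r; lra.
  apply: le_trans (expR_ge1Dx _); rewrite lerD2l lerN2.
  by rewrite -muln2 natrM -natr1 ler_wpM2l// lef_pV2 ?posrE; lra.
rewrite -expRD ler_expR le_eqVlt; apply/orP; left; apply/eqP.
by rewrite -(natr1 m) -(natr1 j); field; lra.
Qed.

(** The inverse of a factor is [1 + i / (2 (m - i))], at most
[expR (i / (2 (m - j)))] for [i <= j]. *)
Lemma weight_ge m j : (j < m)%N ->
  expR (- (j%:R * (j%:R - 1) / (4 * (m%:R - j%:R)))) <= weight m j.
Proof.
move=> jm.
have D0 : 0 < m%:R - j%:R :> R by rewrite subr_gt0 ltr_nat.
suff H i : (i <= j)%N ->
  expR (- (i%:R * (i%:R - 1) / (4 * (m%:R - j%:R)))) <= weight m i by exact: H.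
elim: i => [_|i IH ij]; first by rewrite /weight big_ord0 !mul0r oppr0 expR0.
have ij' : i%:R + 1 <= j%:R :> R by rewrite natr1 ler_nat.
have i0 : 0 <= i%:R :> R by [].
rewrite weightS.
apply: (@le_trans _ _ (expR (- (i%:R * (i%:R - 1) / (4 * (m%:R - j%:R)))) *
  expR (- (i%:R / (2 * (m%:R - j%:R)))))).
  rewrite -expRD ler_expR -natr1 le_eqVlt; apply/orP; left; apply/eqP.
  by field; rewrite gt_eqF.
apply: ler_pM; rewrite ?expR_ge0//; first exact/IH/ltnW.
rewrite expRN.
have -> : 1 - i%:R / (m.*2%:R - i%:R) = (1 + i%:R / (2 * (m%:R - i%:R)))^-1 :> R.
  by rewrite -muln2 natrM; field; lra.
have p : 0 <= i%:R / (2 * (m%:R - i%:R)) :> R by rewrite divr_ge0//; lra.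
rewrite lef_pV2 ?posrE ?expR_gt0//; last lra.
apply: le_trans (expR_ge1Dx _); rewrite lerD2l ler_wpM2l// lef_pV2 ?posrE; lra.
Qed.

(** Index [m] stands for [m.+1] matches in each box, which makes the scaling
factor nonzero for every index. *)
Definition mesh m : R := (Num.sqrt m.+1%:R)^-1.

Lemma mesh_gt0 m : 0 < mesh m.
Proof. by rewrite invr_gt0 sqrtr_gt0. Qed.

Lemma mesh_sqr m : mesh m ^+ 2 = m.+1%:R^-1.
Proof. by rewrite exprVn sqr_sqrtr. Qed.

Lemma mesh_le1 m : mesh m <= 1.
Proof. by rewrite invf_le1 ?sqrtr_gt0// -[leLHS]sqrtr1 ler_wsqrtr// ler1n. Qed.

Lemma cvg_mesh : mesh @ \oo --> 0.
Proof.
have -> : mesh = (Num.sqrt \o @harmonic R).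
  by apply/funext => m; rewrite /mesh /= /harmonic sqrtrV.
rewrite -[X in _ --> X](@sqrtr0 R).
exact: (continuous_cvg _ (@sqrt_continuous R 0) cvg_harmonic).
Qed.

Definition cell m (t : R) : nat := Num.truncn (t / mesh m).

Lemma cell_itv m t : 0 <= t ->
  (cell m t)%:R * mesh m <= t < (cell m t).+1%:R * mesh m.
Proof.
move=> t0; rewrite -ler_pdivlMr ?mesh_gt0// -ltr_pdivrMr ?mesh_gt0//.
by apply: truncn_itv; rewrite divr_ge0// ltW ?mesh_gt0.
Qed.

Lemma cvg_cell t : 0 <= t -> (cell m t)%:R * mesh m @[m --> \oo] --> t.
Proof.
move=> t0; apply: (@squeeze_cvgr _ _ _ _ (fun m => t - mesh m) (fun=> t)).
- near=> m; have := cell_itv m _ t0; rewrite -natr1 mulrDl mul1r; lra.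
- rewrite -[X in _ --> X]subr0; apply: cvgB; [exact: cvg_cst|exact: cvg_mesh].
- exact: cvg_cst.
Unshelve. all: by end_near. Qed.

(** The sequence is [(m - cell m t) / (m + 1)], the factor by which the exponents
of the two bounds on [weight m (cell m t)] differ. *)
Lemma cvg_slack t : 0 <= t ->
  1 - mesh m ^+ 2 - (cell m t)%:R * mesh m * mesh m @[m --> \oo] --> (1 : R).
Proof.
move=> t0; rewrite -[X in _ --> X]subr0 -[X in _ --> X - _]subr0.
rewrite -[X in _ - X - _](mul0r (0 : R)) -[X in _ --> _ - X](mulr0 t).
apply: cvgB; last by apply: cvgM; [exact: cvg_cell|exact: cvg_mesh].
by apply: cvgB; [exact: cvg_cst|apply: cvgM; exact: cvg_mesh].
Qed.

Lemma near_cell_lt t : 0 <= t -> \forall m \near \oo, (cell m t < m)%N.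
Proof.
move=> t0; near=> m.
have s : 0 < 1 - mesh m ^+ 2 - (cell m t)%:R * mesh m * mesh m.
  near: m; exact: (cvgr_gt _ (cvg_slack _ t0)).
rewrite -(ltr_nat R) -subr_gt0 -(pmulr_lgt0 _ (exprn_gt0 2 (mesh_gt0 m))).
suff -> : (m%:R - (cell m t)%:R) * mesh m ^+ 2 =
  1 - mesh m ^+ 2 - (cell m t)%:R * mesh m * mesh m by [].
have : m.+1%:R * mesh m ^+ 2 = 1 by rewrite mesh_sqr divff.
rewrite -natr1 mulrDl mul1r => e.
by lra.
Unshelve. all: by end_near. Qed.

Lemma cvg_weight t : 0 <= t ->
  weight m (cell m t) @[m --> \oo] --> expR (- (t ^+ 2 / 4)).
Proof.
move=> t0.
have cu := cvg_cell _ t0; have cv := cvg_mesh; have cs := cvg_slack _ t0.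
pose u m := (cell m t)%:R * mesh m.
have cuu : u m * (u m - mesh m) / 4 @[m --> \oo] --> t ^+ 2 / 4.
  apply: cvgM; last exact: cvg_cst.
  by apply: cvgM => //; rewrite -[X in _ --> X]subr0; exact: cvgB.
have ce (w : nat -> R) l : w @ \oo --> l -> expR (- w m) @[m --> \oo] --> expR (- l).
  by move=> h; apply: (continuous_cvg _ (@continuous_expR R (- l))); exact: cvgN.
apply: (@squeeze_cvgr _ _ _ _
  (fun m => expR (- (u m * (u m - mesh m) / 4 / (1 - mesh m ^+ 2 - u m * mesh m))))
  (fun m => expR (- (u m * (u m - mesh m) / 4)))).
- near=> m.
  have cm : (cell m t < m)%N by near: m; exact: near_cell_lt.
  have M0 : 0 < m.+1%:R :> R by [].
  have v0 := mesh_gt0 m.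
  have Mv : m.+1%:R = (mesh m ^+ 2)^-1 by rewrite mesh_sqr invrK.
  apply/andP; split.
    apply: le_trans (weight_ge _ _ cm); rewrite ler_expR lerN2.
    have D0 : 0 < m%:R - (cell m t)%:R :> R by rewrite subr_gt0 ltr_nat.
    have mE : m%:R = (mesh m ^+ 2)^-1 - 1 by rewrite -Mv -natr1 addrK.
    rewrite le_eqVlt; apply/orP; left; apply/eqP; rewrite /u.
    have -> : 1 - mesh m ^+ 2 - (cell m t)%:R * mesh m * mesh m =
      (m%:R - (cell m t)%:R) * mesh m ^+ 2.
      by rewrite mE; field; rewrite gt_eqF.
    by field; rewrite !gt_eqF.
  apply: le_trans (weight_le _ _ (ltnW cm)) _.
  rewrite Mv /u le_eqVlt; apply/orP; left; apply/eqP; congr (expR (- _)).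
  by field; rewrite gt_eqF.
- apply: ce; rewrite -[X in _ --> X]divr1.
  by apply: cvgM => //; apply: cvgV => //; exact: oner_neq0.
- exact: ce.
Unshelve. all: by end_near. Qed.

End weight.

Section weighted_law.
Context d (T : measurableType d) (R : realType) (P : probability T R).
Variable C : nat -> {RV P >-> bool}.
Hypothesis fair : fair_choices C.

Lemma weight_total m :
  'C(m.*2, m)%:R / 2 ^+ m.*2 * (\sum_(j < m.+1) weight m j) = 1 :> R.
Proof.
have := remaining_matches_law _ _ _ _ _ fair m setT.
rewrite preimage_setT probability_setT => -[tot]; rewrite [RHS]tot.
rewrite mulr_sumr; apply: eq_big => j; first by rewrite in_setT.
by move=> _; rewrite binomial_weight// -ltnS.
Qed.

(** The probability of a single remaining match cancels, as the probabilities add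
up to 1. *)
Lemma remaining_matches_weight m (A : set R) :
  P (remaining_matches m.+1 C @^-1` A) =
  ((\sum_(j < m.+1 | j.+1%:R \in A) weight m j) /
   \sum_(j < m.+1) weight m j)%:E.
Proof.
rewrite remaining_matches_law//; congr _%:E.
transitivity ('C(m.*2, m)%:R / 2 ^+ m.*2 *
    (\sum_(j < m.+1 | j.+1%:R \in A) weight m j) : R).
  by rewrite mulr_sumr; apply: eq_bigr => j _; rewrite binomial_weight// -ltnS.
have tot := weight_total m.
have s0 : \sum_(j < m.+1) weight m j != 0 :> R.
  by apply: contra_eq_neq tot => ->; rewrite mulr0 eq_sym oner_neq0.
by rewrite -[X in X * _](mulfK s0) tot mul1r mulrC.
Qed.

End weighted_law.

(** * Riemann sums and the half-normal law *)

Section riemann.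
Context {R : realType}.
Local Notation mu := (@lebesgue_measure R).

Definition step m (g : nat -> R) (t : R) : R :=
  \sum_(j < m.+1)
    g j * \1_(`[j%:R * mesh m, j.+1%:R * mesh m[%classic : set R) t.

Lemma measurable_step m g : measurable_fun [set: R] (step m g).
Proof.
apply: measurable_sum => j; apply: measurable_funM => //.
Qed.

Lemma integral_step m g :
  (\int[mu]_t (step m g t)%:E = ((\sum_(j < m.+1) g j) * mesh m)%:E)%E.
Proof.
have v0 := @mesh_gt0 R m.
under eq_integral do rewrite /step -sumEFin.
have cellE (j : nat) : mu (`[j%:R * mesh m, j.+1%:R * mesh m[%classic : set R) =
    (mesh m)%:E.
  rewrite lebesgue_measure_itv /= lte_fin ltr_pM2r// ltr_nat ltnSn.
  by rewrite -EFinB -natr1 mulrDl mul1r addrAC subrr add0r.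
have ii (j : nat) : mu.-integrable [set: R]
    (fun t => (\1_(`[j%:R * mesh m, j.+1%:R * mesh m[%classic : set R) t)%:E).
  exact: integrable_indic_itv.
rewrite integral_sum//; last first.
  move=> j; under eq_fun do rewrite EFinM; exact: integrableZl.
rewrite mulr_suml -sumEFin; apply: eq_bigr => j _.
under eq_integral do rewrite EFinM.
by rewrite integralZl// integral_indic// setIT EFinM; congr (_ * _)%E; exact: cellE.
Qed.

Lemma step_cell m g t : 0 <= t ->
  step m g t = if (cell m t < m.+1)%N then g (cell m t) else 0.
Proof.
move=> t0; have := cell_itv m _ t0; set c := cell m t => /andP[ct tc].
have off j : j != c ->
    \1_(`[j%:R * mesh m, j.+1%:R * mesh m[%classic : set R) t = 0 :> R.
  move=> jc; rewrite indicE memNset//= in_itv/= => /andP[jt tj].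
  have := le_lt_trans jt tc; have := le_lt_trans ct tj.
  by rewrite !ltr_pM2r ?mesh_gt0// !ltr_nat; move/eqP: jc; lia.
case: ifPn => cm.
  rewrite /step (bigD1 (Ordinal cm))//= big1 ?addr0.
    by rewrite indicE mem_set ?mulr1//= in_itv/= ct.
  by move=> j jc; rewrite off ?mulr0//; apply: contraNneq jc => ?; exact/eqP/val_inj.
rewrite /step big1// => j _; rewrite off ?mulr0//.
by apply: contraNneq cm => <-.
Qed.

Lemma step_lt0 m g t : t < 0 -> step m g t = 0.
Proof.
move=> t0; rewrite /step big1// => j _.
rewrite indicE memNset ?mulr0//= in_itv/= => /andP[jt _].
have : 0 <= j%:R * mesh m :> R by rewrite mulr_ge0// ltW ?mesh_gt0.
by move/le_trans/(_ jt); rewrite leNgt t0.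
Qed.

(** An integrable bound that is uniform in [m].  With [y = t / mesh m] and
[c = cell m t], so that [c <= y < c + 1], one has
[y ^ 2 - 3 y <= c (c - 1)]; multiplying by [mesh m ^ 2], where [mesh m <= 1],
bounds the exponent of [weight_le] by [- (t ^ 2 - 3 t) / 4], and completing the
square gives the Gaussian centred at [3 / 2]. *)
Lemma weight_cell_le m (t : R) : 0 <= t -> (cell m t <= m)%N ->
  weight m (cell m t) <= expR ((9 / 4 - (t - 3 / 2) ^+ 2) / 4).
Proof.
move=> t0 cm; apply: le_trans (weight_le _ _ cm) _.
rewrite ler_expR.
have -> : m.+1%:R = (mesh m ^+ 2)^-1 :> R by rewrite mesh_sqr invrK.
have v0 := @mesh_gt0 R m; have v1 := @mesh_le1 R m.
have := cell_itv m _ t0; rewrite -ler_pdivlMr// -ltr_pdivrMr//.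
have tE : t = t / mesh m * mesh m by field; rewrite gt_eqF.
have y0 : 0 <= t / mesh m by rewrite divr_ge0// ltW.
set y := t / mesh m in tE y0 *; case/andP.
move: (cell m t) => c; rewrite -natr1 => cy yc.
have q : y ^+ 2 - 3 * y <= c%:R * (c%:R - 1).
  have : 0 <= (y - c%:R) * (c%:R + 1 - y) by rewrite mulr_ge0//; lra.
  case: c cy yc => [|c] cy yc; first by nra.
  by rewrite -natr1 in cy yc *; have : 0 <= c%:R :> R by []; nra.
have : (y ^+ 2 - 3 * y) * mesh m ^+ 2 <= c%:R * (c%:R - 1) * mesh m ^+ 2.
  by rewrite ler_wpM2r// exprn_ge0// ltW.
have -> : c%:R * (c%:R - 1) / (4 * (mesh m ^+ 2)^-1) =
  c%:R * (c%:R - 1) * mesh m ^+ 2 / 4 :> R by field; rewrite gt_eqF.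
have : t * mesh m <= t by rewrite ler_piMr.
have -> : (y ^+ 2 - 3 * y) * mesh m ^+ 2 = t ^+ 2 - 3 * (t * mesh m).
  by rewrite [in RHS]tE; ring.
by move: (_ * mesh m ^+ 2) (t * mesh m) => A B; nra.
Qed.

Variables (s2 : {posnum R}) (s2E : s2%:num ^+ 2 = 2 :> R).

Lemma halfnormal_sqrt2E (t : R) : 0 <= t ->
  halfnormal_pdf s2%:num t = halfnormal_pdf s2%:num 0 * expR (- (t ^+ 2 / 4)).
Proof.
move=> t0; rewrite /halfnormal_pdf t0 lexx expr0n mul0r oppr0 expR0 mulr1.
by rewrite s2E -natrM.
Qed.

(** The sum is the integral of the step function that equals the weight of
[cell m t] at [t], cut off by the test [b m].  The hypothesis on [b] makes the
cut-off converge to the indicator of [B] at every [t >= 0], so that the step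
functions converge pointwise to the density on [B]. *)
Lemma cvg_riemann (b : nat -> nat -> bool) (B : set R) : measurable B ->
  (forall t, 0 <= t -> \forall m \near \oo, b m (cell m t) = (t \in B)) ->
  (halfnormal_pdf s2%:num 0 * (\sum_(j < m.+1 | b m j) weight m j) * mesh m)%:E
    @[m --> \oo] --> halfnormal_prob s2 B.
Proof.
move=> mB bB; set k := halfnormal_pdf _ 0.
have k0 : 0 <= k by exact: halfnormal_pdf_ge0.
pose g m j := if b m j then k * weight m j else 0.
have -> : (fun m => (k * (\sum_(j < m.+1 | b m j) weight m j) * mesh m)%:E) =
    (fun m => \int[mu]_t (step m (g m) t)%:E)%E.
  by apply/funext => m; rewrite integral_step mulr_sumr big_mkcond.
rewrite /halfnormal_prob integral_mkcond.
(* The dominating function has to be a multiple of a normal density, whose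
   integrability is known. *)
pose K := k * expR (9 / 16) / normal_peak s2%:num.
have GE t : K * normal_pdf (3 / 2) s2%:num t =
    k * expR ((9 / 4 - (t - 3 / 2) ^+ 2) / 4).
  have p0 : normal_peak s2%:num != 0 :> R by rewrite gt_eqF ?normal_peak_gt0.
  rewrite normal_pdfE// /K mulrA divfK// /normal_fun -mulrA -expRD.
  by rewrite s2E; congr (_ * expR _); field.
apply: (@dominated_cvg _ _ _ mu setT measurableT
  (fun m t => (step m (g m) t)%:E) _
  (fun t => (K * normal_pdf (3 / 2) s2%:num t)%:E)) => //.
- by move=> m; apply/measurable_EFinP; exact: measurable_step.
- move=> t _; rewrite patchE.
  have -> : (if t \in B then (halfnormal_pdf s2%:num t)%:E else 0%E) =
      (if t \in B then halfnormal_pdf s2%:num t else 0)%:E by case: ifP.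
  apply: cvg_EFin; first exact: nearW.
  have [t0|t0] := ltP t 0.
    under eq_fun do rewrite /= step_lt0//.
    rewrite /halfnormal_pdf leNgt t0 /=; case: ifP => _; exact: cvg_cst.
  have cE : \forall m \near \oo,
      (if t \in B then k * weight m (cell m t) else 0) = fine (step m (g m) t)%:E.
    near=> m; rewrite step_cell// /g ltnW; last first.
      by rewrite ltnS; near: m; exact: near_cell_lt.
    by have -> : b m (cell m t) = (t \in B) by near: m; exact: bB.
  apply: cvg_trans (near_eq_cvg cE) _.
  case: ifP => _; last exact: cvg_cst.
  rewrite halfnormal_sqrt2E//; apply: cvgM; first exact: cvg_cst.
  exact: cvg_weight.
- under eq_fun do rewrite EFinM.
  by apply: integrableZl => //; exact: integrable_normal_pdf.
- move=> m t _; rewrite GE lee_fin.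
  have h0 : 0 <= k * expR ((9 / 4 - (t - 3 / 2) ^+ 2) / 4).
    by rewrite mulr_ge0// expR_ge0.
  have [t0|t0] := ltP t 0; first by rewrite step_lt0// normr0.
  rewrite step_cell//; case: ifP => [cm|_]; last by rewrite normr0.
  rewrite /g; case: ifP => _; last by rewrite normr0.
  rewrite ger0_norm ?mulr_ge0// ?weight_ge0//.
  by rewrite ler_wpM2l// weight_cell_le.
Unshelve. all: by end_near. Qed.

End riemann.

(** * Convergence in distribution *)

Theorem mainTheorem7 (R : realType) (d : nat -> measure_display)
    (T : forall n : nat, measurableType (d n))
    (P : forall n : nat, probability (T n) R)
    (C : forall n : nat, nat -> {RV (P n) >-> bool}) :
  (forall n : nat, fair_choices (C n)) ->
  cvg_in_distribution
    (fun n : nat => (Num.sqrt n%:R)^-1 \o* remaining_matches n (C n)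
                    : {RV (P n) >-> R})
    (halfnormal_prob (Num.sqrt 2)%:pos).
Proof.
move=> fair x _; rewrite -cvg_shiftS /=.
set s : {posnum R} := (Num.sqrt 2)%:pos.
have sE : s%:num ^+ 2 = 2 :> R by rewrite sqr_sqrtr.
pose k : R := halfnormal_pdf s%:num 0.
have k0 : k != 0.
  rewrite /k /halfnormal_pdf lexx mulf_neq0// gt_eqF ?expR_gt0// sqrtr_gt0.
  by rewrite divr_gt0// mulr_gt0 ?pi_gt0// exprn_gt0.
pose S (b : nat -> pred nat) m : R :=
  k * (\sum_(j < m.+1 | b m j) weight m j) * mesh m.
pose below m : pred nat := fun j => j.+1%:R * mesh m <= x.
have cdfE m : cdf ((Num.sqrt m.+1%:R)^-1 \o* remaining_matches m.+1 (C m.+1)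
      : {RV (P m.+1) >-> R}) x = (S below m / S (fun=> predT) m)%:E.
  transitivity (P m.+1 (remaining_matches m.+1 (C m.+1) @^-1`
      [set y | y * mesh m <= x])).
    by congr (P m.+1 _); apply/seteqP; split => t /=; rewrite in_itv.
  rewrite (remaining_matches_weight _ _ _ _ _ (fair m.+1)); congr _%:E.
  have v0 : mesh m != 0 :> R by rewrite gt_eqF// mesh_gt0.
  rewrite /S -mulf_div mulfV// mulr1 -mulf_div mulfV// mul1r.
  congr (_ / _); apply: eq_bigl => j.
  by apply/idP/idP => [/set_mem//|h]; exact/mem_set.
(* At [t = x] the test fails for every [m], because
   [x < (cell m x).+1 * mesh m]: the limit set is the open interval. *)
have S1 : (S below m)%:E @[m --> \oo] --> halfnormal_prob s `]-oo, x[%classic.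
  apply: cvg_riemann => // t t0.
  have [tx|tx] := ltP t x.
    rewrite mem_set//=.
    have : (cell m t)%:R * mesh m + mesh m @[m --> \oo] --> t + 0.
      by apply: cvgD; [exact: cvg_cell|exact: cvg_mesh].
    rewrite addr0 => /cvgr_lt /(_ x tx); apply: filterS => m /ltW.
    by rewrite /below -natr1 mulrDl mul1r => ->.
  rewrite memNset/=; last by rewrite in_itv/= ltNge tx.
  near=> m; apply/negbTE; rewrite -ltNge (le_lt_trans tx)//.
  by have /andP[] := cell_itv m _ t0.
have S2 : (S (fun=> predT) m)%:E @[m --> \oo] --> 1%E.
  rewrite -(probability_setT (halfnormal_prob s)).
  by apply: cvg_riemann => // t _; near=> m; rewrite in_setT.
have -> : halfnormal_prob s `]-oo, x]%classic =
    halfnormal_prob s `]-oo, x[%classic.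
  rewrite /halfnormal_prob -integral_itv_bndo_bndc//.
  by apply/measurable_EFinP/measurable_funTS; exact: measurable_halfnormal_pdf.
rewrite [X in X @ _ --> _](_ : _ =
  fun m => (S below m / S (fun=> predT) m)%:E); last exact/funext/cdfE.
have pf : halfnormal_prob s `]-oo, x[%classic \is a fin_num.
  exact: fin_num_measure.
rewrite -(fineK pf) in S1 *.
apply: cvg_EFin; first exact: nearW.
rewrite -[X in _ --> X]divr1; apply: cvgM; first exact: fine_cvg S1.
by apply: cvgV; [exact: oner_neq0|exact: fine_cvg S2].
Unshelve. all: by end_near. Qed.
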